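(* There exists a simple algorithm with a simple proof that, given a maximum degree $\Delta$ and a predetermined non-accessible graph $G$ with $n$ vertices and maximum degree $\Delta$, finds one list $L(v)\subseteq[\Delta+1]$ per vertex $v$, of average size $O(\log n\,\log\Delta)$, together with a permutation of the vertices, such that the greedy algorithm, where the vertices are processed in the permutation order, correctly colors the vertices of $G$.
   Context: $[k]=\{1,\dots,k\}$. A vertex coloring of $G$ assigns colors to the vertices so that no two adjacent vertices have the same color; here each vertex $v$ must receive a color from its list $L(v)$. ''Non-accessible'' means that the list-finding algorithm uses no information about the graph except its maximum degree (and its vertex set); in particular it does not query the edges of $G$. Greedy algorithm: as long as no failure is encountered, take the next uncolored vertex $v$ in the permutation order and look for a color in $L(v)$ that is unused by any of the neighbors of $v$. If such a color exists, color $v$ with it; otherwise, fail. The algorithm is randomized: it assigns a suitably chosen random number $X_v$ to each vertex $v$, and the permutation orders the vertices by nondecreasing $X_v$. The success of the greedy algorithm is meant with high probability. *)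

(* Defs.v *)
From mathcomp Require Import all_boot all_order all_algebra.
From mathcomp Require Import reals exp.

Set Implicit Arguments.
Unset Strict Implicit.
Unset Printing Implicit Defensive.

Import Order.TTheory GRing.Theory Num.Theory.
Local Open Scope ring_scope.

(* Randomized algorithms are programs of a small imperative language with     *)
(* bounded loops and uniform random draws.  The memory consists of            *)
(* two-dimensional arrays of natural numbers, [s x i j] being the cell [i, j] *)
(* of array [x]; a scalar variable is the cell [0, 0] of its array.           *)

Definition state := nat -> nat -> nat -> nat.

Definition store (s : state) (x i j k : nat) : state :=
  fun x' i' j' => if [&& x' == x, i' == i & j' == j] then k else s x' i' j'.

Inductive expr :=
  | Const of nat
  | Read of nat & expr & expr
  | Add of expr & expr
  | Sub of expr & expr
  | Mul of expr & expr
  | Div of expr & expr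
  | Mod of expr & expr
  | Leq of expr & expr.

Fixpoint eval (s : state) (a : expr) : nat :=
  match a with
  | Const k => k
  | Read x a1 a2 => s x (eval s a1) (eval s a2)
  | Add a1 a2 => (eval s a1 + eval s a2)%N
  | Sub a1 a2 => (eval s a1 - eval s a2)%N
  | Mul a1 a2 => (eval s a1 * eval s a2)%N
  | Div a1 a2 => (eval s a1 %/ eval s a2)%N
  | Mod a1 a2 => (eval s a1 %% eval s a2)%N
  | Leq a1 a2 => (eval s a1 <= eval s a2)%N
  end.

(* [Rand x i j a] stores in [x[i, j]] a fresh uniform element of {0, ..., a}; *)
(* [For x a p] runs [p] with the scalar [x] set to 0, 1, ..., a - 1           *)
(* successively, the bound [a] being evaluated once, before the loop.         *)
Inductive prog :=
  | Skip
  | Assign of nat & expr & expr & expr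
  | Rand of nat & expr & expr & expr
  | Seq of prog & prog
  | If of expr & prog & prog
  | For of nat & expr & prog.

(* Every program terminates, and makes boundedly many draws from finite       *)
(* ranges.  [expect p f s] is the expected value of [f] in the final state    *)
(* when [p] is run from the state [s], all draws being independent.           *)
Fixpoint expect (R : realType) (p : prog) (f : state -> R) (s : state) : R :=
  match p with
  | Skip => f s
  | Assign x i j a => f (store s x (eval s i) (eval s j) (eval s a))
  | Rand x i j a =>
      (\sum_(k < (eval s a).+1) f (store s x (eval s i) (eval s j) k))
      / (eval s a).+1%:R
  | Seq p1 p2 => expect p1 (expect p2 f) s
  | If a p1 p2 => if eval s a != 0%N then expect p1 f s else expect p2 f s
  | For x a p1 =>
      foldr (fun k g s' => expect p1 g (store s' x 0 0 k)) f
        (iota 0 (eval s a)) s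
  end.

(* The graph is not accessible: a program is only given the number of         *)
(* vertices and the maximum degree, in the arrays 0 and 1.  It outputs a      *)
(* number X_v per vertex in array 2, and in array 3 the 0/1-matrix of the     *)
(* lists.  The colors 1, ..., Delta + 1 are represented by 'I_Delta.+1.       *)

Definition input (n Delta : nat) : state :=
  store (store (fun _ _ _ => 0%N) 0 0 0 n) 1 0 0 Delta.

Definition outX (n : nat) (s : state) (v : 'I_n) : nat := s 2 v 0.

Definition outL (n Delta : nat) (s : state) (v : 'I_n) : {set 'I_Delta.+1} :=
  [set c : 'I_Delta.+1 | s 3 v c != 0%N].

Definition expectation (R : realType) (A : prog) (n Delta : nat)
    (f : state -> R) : R :=
  expect A f (input n Delta).

Definition probability (R : realType) (A : prog) (n Delta : nat)
    (P : pred state) : R :=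
  expectation A n Delta (fun s => (P s)%:R).

Definition avg_size (R : realType) (n Delta : nat)
    (L : 'I_n -> {set 'I_Delta.+1}) : R :=
  (\sum_(v < n) #|L v|%:R) / n%:R.

(* Ties are broken by vertex number, as [sort] is stable. *)
Definition order_by (n : nat) (X : 'I_n -> nat) : seq 'I_n :=
  sort (fun u v => X u <= X v)%N (enum 'I_n).

Definition max_degree (n : nat) (e : rel 'I_n) : nat :=
  \max_(v < n) #|[set u | e v u]|.

Section Greedy.

Variables (n Delta : nat) (e : rel 'I_n) (L : 'I_n -> {set 'I_Delta.+1}).

Definition partial_coloring := {ffun 'I_n -> option 'I_Delta.+1}.

(* Greedy may color a vertex with any usable color of its list; a choice rule *)
(* picks one, knowing the colors given so far, the vertex, and the nonempty   *)
(* set of its usable colors.                                                  *)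
Definition choice_rule :=
  partial_coloring -> 'I_n -> {set 'I_Delta.+1} -> 'I_Delta.+1.

Definition valid_rule (sel : choice_rule) : Prop :=
  forall col v (U : {set 'I_Delta.+1}), U != set0 -> sel col v U \in U.

Definition usable (col : partial_coloring) (v : 'I_n) : {set 'I_Delta.+1} :=
  [set c in L v | [forall u, e v u ==> (col u != Some c)]].

Fixpoint greedy_from (sel : choice_rule) (col : partial_coloring)
    (s : seq 'I_n) : option partial_coloring :=
  if s is v :: s' then
    if usable col v == set0 then None
    else greedy_from sel
           [ffun u => if u == v then Some (sel col v (usable col v)) else col u]
           s'
  else Some col.

Definition greedy (sel : choice_rule) (s : seq 'I_n) :
    option partial_coloring :=
  greedy_from sel [ffun=> None] s.

Definition list_coloring (col : partial_coloring) : bool :=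
  [forall v, if col v is Some c then c \in L v else false]
  && [forall u, forall v, e u v ==> (col u != col v)].

Definition greedy_correct (sel : choice_rule) (s : seq 'I_n) : bool :=
  if greedy sel s is Some col then list_coloring col else false.

End Greedy.

(* Main.v *)
Require Import Defs.
From mathcomp Require Import all_boot all_order all_algebra.
From mathcomp Require Import boolp reals sequences exp.
From mathcomp Require Import zify ring lra.

Set Implicit Arguments.
Unset Strict Implicit.
Unset Printing Implicit Defensive.

Import Order.TTheory GRing.Theory Num.Theory.
Local Open Scope ring_scope.

(* Every vertex v draws a rank x uniformly in {0, ..., Delta}, and puts each  *)
(* color in its list independently with probability p, where p = 1 or         *)
(* p (Delta - x) >= K; here K is (c + 1) times the bit length of n.  When     *)
(* greedy reaches v, only neighbors of rank at most x have been colored, so,  *)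
(* if v has degree d <= Delta and m neighbors of rank more than x, at least   *)
(* Delta + 1 - d + m colors are free.  The list of v is independent of them   *)
(* and misses them all with probability at most (1 - p)^(Delta + 1 - d + m).  *)
(* As m is binomial with parameters d and q = (Delta - x) / (Delta + 1), the  *)
(* mean of this over the ranks of the neighbors is                            *)
(*   (1 - p)^(Delta + 1 - d) (1 - p q)^d <= (1 - K / (Delta + 1))^(Delta + 1) *)
(* (or 0 if p = 1), hence at most exp (- K) <= n^-(c + 1).  The expected list *)
(* size is O(K) times a harmonic sum over Delta - x.  The list sizes are      *)
(* independent, of size at most Delta + 1 <= n, so a Chernoff bound gives the *)
(* concentration of their average.                                            *)

(** A vertex of small rank meets few colored neighbors and so can afford a short list; only late
    vertices need long ones. This makes the total size a harmonic sum. By [expectation_list_prog],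
    each expectation over a run of the program is a finite average over one independent element of
    [draws Delta] per vertex. A greedy run that does not fail is automatically a list coloring, so
    failure is covered by the events [stuck], one per vertex ([greedy_incorrect_stuck]). For a
    single vertex, decisions are deferred: everything but its list is fixed, which determines its
    free colors ([stuck_disjoint], [card_free_colors]). Its list draws are then averaged
    ([avg_stuck_rank]), and next the ranks of its neighbors ([avg_failure]). The union bound is
    [avg_failures]. Sizes are handled by [sum_color_prob_le] for the mean and [avg_size_tail] for
    the tail. *)

Definition avg (R : realType) (T : finType) (F : T -> R) : R :=
  (\sum_t F t) / #|T|%:R.

(** * Finite averages: Fubini, independence, resampling of a coordinate *)

Section Average.

Variable R : realType.
Implicit Types T I : finType.

Lemma eq_avg T (F G : T -> R) : F =1 G -> avg F = avg G.
Proof. by move=> FG; rewrite /avg (eq_bigr G). Qed.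

Lemma avg_const T (a : R) : (0 < #|T|)%N -> avg (fun _ : T => a) = a.
Proof.
by move=> T0; rewrite /avg sumr_const -[a *+ _]mulr_natr mulfK // pnatr_eq0 -lt0n.
Qed.

Lemma ler_avg T (F G : T -> R) : (forall t, F t <= G t) -> avg F <= avg G.
Proof.
by move=> FG; rewrite ler_wpM2r ?invr_ge0// ler_sum.
Qed.

Lemma avg_ge0 T (F : T -> R) : (forall t, 0 <= F t) -> 0 <= avg F.
Proof. by move=> F0; rewrite divr_ge0// sumr_ge0. Qed.

Lemma avg_le_const T (F : T -> R) (a : R) :
  (0 < #|T|)%N -> (forall t, F t <= a) -> avg F <= a.
Proof. by move=> T0 Fa; rewrite -[leRHS](avg_const _ T0) ler_avg. Qed.

Lemma avg_sum T I (P : pred I) (F : I -> T -> R) :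
  avg (fun t => \sum_(i | P i) F i t) = \sum_(i | P i) avg (F i).
Proof. by rewrite /avg exchange_big mulr_suml. Qed.

Lemma avgZ T (a : R) (F : T -> R) : avg (fun t => a * F t) = a * avg F.
Proof. by rewrite /avg -mulr_sumr mulrA. Qed.

Lemma avgB T (F G : T -> R) : avg (fun t => F t - G t) = avg F - avg G.
Proof. by rewrite /avg sumrB mulrBl. Qed.

Lemma avg_bij T T' (h : T -> T') (F : T' -> R) :
  bijective h -> avg (fun t => F (h t)) = avg F.
Proof.
move=> hb; rewrite /avg (bij_eq_card hb); congr (_ / _).
by rewrite [RHS](reindex h)//; apply: onW_bij.
Qed.

Lemma avg_pair T T' (F : T * T' -> R) :
  avg F = avg (fun t => avg (fun t' => F (t, t'))).
Proof.
rewrite /avg card_prod natrM invfM mulrA -mulr_suml [RHS]mulrAC.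
by rewrite pair_bigA; congr (_ / _ / _); apply: eq_bigr => -[].
Qed.

Lemma exchange_avg T T' (F : T -> T' -> R) :
  avg (fun t => avg (F t)) = avg (fun t' => avg (F^~ t')).
Proof.
by rewrite /avg -!mulr_suml exchange_big mulrAC.
Qed.

(** Independence of the coordinates, obtained by expanding a product of sums. *)
Lemma avg_ffun_prod T I (g : I -> T -> R) :
  avg (fun w : {ffun I -> T} => \prod_i g i (w i)) = \prod_i avg (g i).
Proof.
rewrite /avg card_ffun natrX -bigA_distr_bigA big_split/=.
by congr (_ * _); rewrite prodr_const exprVn.
Qed.

Definition update T I (w : {ffun I -> T}) (v : I) (t : T) : {ffun I -> T} :=
  [ffun u => if u == v then t else w u].

(** The tool for deferred decisions: a coordinate may be redrawn without changing the distribution,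
    because exchanging the old and the fresh value is an involution on pairs. *)
Lemma avg_update T I (v : I) (F : {ffun I -> T} -> R) :
  (0 < #|T|)%N ->
  avg F = avg (fun w => avg (fun t => F (update w v t))).
Proof.
move=> T0; rewrite -(avg_pair (fun p => F (update p.1 v p.2))).
pose swap (p : {ffun I -> T} * T) := (update p.1 v p.2, p.1 v).
have swapK : involutive swap.
  case=> w t; rewrite /swap/= ffunE eqxx; congr (_, _).
  by apply/ffunP => u; rewrite !ffunE; case: eqVneq => // ->.
rewrite -[RHS](avg_bij _ (inv_bij swapK)).
rewrite avg_pair; apply: eq_avg => w /=.
rewrite -[LHS](avg_const _ T0); apply: eq_avg => t; congr F.
by have [] := swapK (w, t).
Qed.

Lemma avg_coord T I (v : I) (g : T -> R) :
  (0 < #|T|)%N -> avg (fun w : {ffun I -> T} => g (w v)) = avg g.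
Proof.
move=> T0; rewrite (avg_update v)//.
under eq_avg do under eq_avg do rewrite ffunE eqxx.
rewrite avg_const // card_ffun expn_gt0 T0//.
Qed.

Lemma avg_unit (F : unit -> R) : avg F = F tt.
Proof. by rewrite -[RHS](@avg_const unit) ?card_unit//; apply: eq_avg => -[]. Qed.

Lemma avg_fst T T' (g : T -> R) :
  (0 < #|T'|)%N -> avg (fun t : T * T' => g t.1) = avg g.
Proof. by move=> T0; rewrite avg_pair; apply: eq_avg => x /=; rewrite avg_const. Qed.

Lemma avg_indicator T (P : pred T) :
  avg (fun t => (P t)%:R) = #|[set t | P t]|%:R / #|T|%:R :> R.
Proof.
rewrite /avg; congr (_ / _); rewrite -sum1dep_card natr_sum [RHS]big_mkcond.
by apply: eq_bigr => t _; case: (P t).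
Qed.

End Average.

(** * From programs to uniform finite outcome spaces *)

Section Sampler.

Variable R : realType.

(* In the outcome [t] of the draws, uniform in [T], the run of [p] from [s]   *)
(* ends in a state satisfying [Q t].                                          *)
Definition sampler (p : prog) (s : state) (T : finType)
    (Q : T -> state -> Prop) : Prop :=
  forall (f : state -> R) (F : T -> R),
    (forall t s', Q t s' -> f s' = F t) -> expect p f s = avg F.

Lemma sampler_weaken p s (T : finType) (Q Q' : T -> state -> Prop) :
  sampler p s Q -> (forall t s', Q t s' -> Q' t s') -> sampler p s Q'.
Proof. by move=> sp QQ' f F fF; apply: sp => t s' /QQ'; apply: fF. Qed.

Lemma sampler_rand x i j a s d : eval s a = d ->
  sampler (Rand x i j a) s
    (fun (t : 'I_d.+1) s' => s' = store s x (eval s i) (eval s j) t).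
Proof.
move=> <- f F fF; rewrite /avg card_ord /=; congr (_ / _).
by apply: eq_bigr => t _; apply: fF.
Qed.

Lemma sampler_seq p1 p2 s (T1 T2 : finType) Q1 (Q2 : T1 * T2 -> state -> Prop) :
  sampler p1 s Q1 ->
  (forall t1 s1, Q1 t1 s1 -> sampler p2 s1 (fun t2 => Q2 (t1, t2))) ->
  sampler (Seq p1 p2) s Q2.
Proof.
move=> sp1 sp2 f F fF /=; rewrite avg_pair; apply: sp1 => t1 s1 Q1s.
by apply: (sp2 _ _ Q1s) => t2 s' /fF.
Qed.

Lemma sampler_assign p x i j a s (T : finType) (Q Q' : T -> state -> Prop) :
  sampler p s Q' ->
  (forall t s', Q' t s' -> Q t (store s' x (eval s' i) (eval s' j) (eval s' a))) ->
  sampler (Seq p (Assign x i j a)) s Q.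
Proof. by move=> sp QQ' f F fF /=; apply: sp => t s' /QQ'; apply: fF. Qed.

(** The loop invariant [J] is indexed by the outcomes of the iterations already run. The body
    samples [T] uniformly from every state satisfying [J], so the iterations are independent. *)
Lemma sampler_for (T : finType) x a p s m (J : seq T -> state -> Prop) :
  eval s a = m -> J [::] s ->
  (forall w s', (size w < m)%N -> J w s' ->
    sampler p (store s' x 0 0 (size w)) (fun t => J (rcons w t))) ->
  sampler (For x a p) s (fun w : {ffun 'I_m -> T} => J [seq w i | i : 'I_m]).
Proof.
move=> am J0 step f F fF /=; rewrite am.
have tupP (w : m.-tuple T) : [seq (finfun (tnth w)) i | i : 'I_m] = w.
  by rewrite /image_mem (eq_map (ffunE _)) map_tnth_enum.
have -> : avg F = avg (fun w : m.-tuple T => F (finfun (tnth w))).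
  rewrite [RHS](@avg_bij _ _ _ (fun w : m.-tuple T => finfun (tnth w))) //.
  exists (fun g : {ffun _ -> _} => [tuple g i | i < m]) => [w|g].
    by apply: eq_from_tnth => i; rewrite tnth_mktuple ffunE.
  by apply/ffunP => i; rewrite ffunE tnth_mktuple.
(* [F] is extended to all sequences, with default 0 on wrong lengths, so that the induction on the
   remaining iterations can append outcomes to a prefix. *)
pose G (w : seq T) := if insub w is Some w then F (finfun (tnth (w : m.-tuple T))) else 0.
have GE (w : m.-tuple T) : G w = F (finfun (tnth w)) by rewrite /G valK.
have fG w s' : size w = m -> J w s' -> f s' = G w.
  move=> sw Jw; have -> : w = Tuple (introT eqP sw) by [].
  by rewrite GE; apply: fF; rewrite tupP.
rewrite -(eq_avg GE) => {fF GE tupP}.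
suff loop b w s' : (size w + b = m)%N -> J w s' ->
    foldr (fun k g s' => expect p g (store s' x 0 0 k)) f (iota (size w) b) s'
    = avg (fun w' : b.-tuple T => G (w ++ w')).
  exact: (loop m [::] s).
elim: b w s' => [|b IHb] w s' /= wm Jw.
  rewrite addn0 in wm; rewrite (fG _ _ wm Jw) -[LHS](@avg_const _ (0.-tuple T)).
    by apply: eq_avg => w'; rewrite tuple0 cats0.
  by rewrite card_tuple.
have sw : (size w < m)%N by rewrite -wm addnS ltnS leq_addr.
rewrite (step _ _ sw Jw _ (fun t => avg (fun w' : b.-tuple T => G (rcons w t ++ w')))).
  rewrite -(avg_pair (fun q : T * b.-tuple T => G (rcons w q.1 ++ q.2))).
  rewrite -(@avg_bij _ _ _ (fun q : T * b.-tuple T => [tuple of q.1 :: q.2])).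
    by apply: eq_avg => q; rewrite cat_rcons.
  exists (fun w : b.+1.-tuple T => (thead w, [tuple of behead w])).
    by case=> t w'; congr (_, _); apply: val_inj.
  by move=> w'; rewrite -tuple_eta.
by move=> t s'' Jt; rewrite -(IHb (rcons w t) s'') ?size_rcons ?addSnnS.
Qed.

End Sampler.

(** * Deterministic analysis of greedy runs *)

Section GreedyRuns.

Variables (n Delta : nat) (e : rel 'I_n).
Implicit Types (L : 'I_n -> {set 'I_Delta.+1}) (sel : choice_rule n Delta).
Implicit Types (col : partial_coloring n Delta) (s : seq 'I_n).

Definition free_colors col v : {set 'I_Delta.+1} :=
  [set c | [forall u, e v u ==> (col u != Some c)]].

Lemma usableE L col v : usable e L col v = L v :&: free_colors col v.
Proof. by apply/setP => c; rewrite !inE. Qed.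

Lemma eq_greedy_from L L' sel col s : {in s, L =1 L'} ->
  greedy_from e L sel col s = greedy_from e L' sel col s.
Proof.
elim: s col => //= v s IHs col LL'.
have -> : usable e L col v = usable e L' col v.
  by rewrite !usableE LL' ?mem_head.
by case: ifP => // _; apply: IHs => u us; apply: LL'; rewrite inE us orbT.
Qed.

Lemma greedy_from_dom L sel col col' s :
  greedy_from e L sel col s = Some col' ->
  forall u, isSome (col' u) = (u \in s) || isSome (col u).
Proof.
elim: s col => [col [->] //|v s IHs col] /=; case: ifP => // _ run u.
by rewrite (IHs _ run) ffunE inE; case: eqVneq => _ //=; rewrite orbT.
Qed.

Definition proper_from L col : Prop := forall v c, col v = Some c ->
  c \in L v /\ forall u, e v u -> col u != Some c.

Lemma greedy_from_proper L sel col col' s :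
  symmetric e -> irreflexive e -> valid_rule sel -> uniq s ->
  {in s, forall v, col v = None} -> proper_from L col ->
  greedy_from e L sel col s = Some col' -> proper_from L col'.
Proof.
move=> esym eirr valid; elim: s col => [col _ _ proper [<-] //|v s IHs col].
move=> /= /andP[vs us] fresh proper; case: ifPn => // usable0.
have := valid col v _ usable0; set c := sel _ _ _.
rewrite usableE !inE => /andP[cL /forallP cfree].
apply: IHs => // [u us'|u d]; rewrite ffunE.
  case: eqVneq => [uv|_]; first by rewrite -uv us' in vs.
  by apply: fresh; rewrite inE us' orbT.
case: eqVneq => [-> [<-]|uv cold].
  split=> // w vw; rewrite ffunE; case: (eqVneq w v) => [wv|_].
    by rewrite wv eirr in vw.
  exact: (implyP (cfree w)).
have [dL dfree] := proper _ _ cold; split=> // w uw; rewrite ffunE.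
case: (eqVneq w v) => [wv|_]; last exact: dfree.
have := implyP (cfree u); rewrite -wv esym => /(_ uw); apply: contraNneq => -[->].
by rewrite cold.
Qed.

(** The run is cut just before [v], so [L v] enters only through the final test. *)
Definition stuck L sel s v : bool :=
  if greedy e L sel (take (index v s) s) is Some col
  then usable e L col v == set0 else false.

Lemma greedy_from_None L sel col s : uniq s ->
  greedy_from e L sel col s = None ->
  exists2 v, v \in s &
    (if greedy_from e L sel col (take (index v s) s) is Some col'
     then usable e L col' v == set0 else false) : bool.
Proof.
elim: s col => // v s IHs col /= /andP[vs us]; case: ifPn => [u0 _|u0].
  by exists v; [rewrite mem_head | rewrite eqxx].
move=> /(IHs _ us)[w ws stuckw]; exists w; first by rewrite inE ws orbT.
have /negPf -> : v != w by apply: contraNneq vs => ->.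
by rewrite /= (negPf u0).
Qed.

(** A completed run colors every vertex and stays proper, since each new color avoids those of all
    neighbors; hence an incorrect run must have failed at some vertex. *)
Lemma greedy_incorrect_stuck L sel s :
  symmetric e -> irreflexive e -> valid_rule sel ->
  uniq s -> (forall v, v \in s) ->
  ~~ greedy_correct e L sel s -> [exists v, stuck L sel s v].
Proof.
move=> esym eirr valid us alls; rewrite /greedy_correct.
case run: (greedy e L sel s) => [col|] incorrect; last first.
  by have [v _ stuckv] := greedy_from_None us run; apply/existsP; exists v.
have fresh : {in s, forall v, [ffun=> None : option 'I_Delta.+1] v = None}.
  by move=> v _; rewrite ffunE.
have proper0 : proper_from L [ffun=> None].
  by move=> v c; rewrite ffunE.
have proper := greedy_from_proper esym eirr valid us fresh proper0 run.
have colored v : isSome (col v) by rewrite (greedy_from_dom run) alls.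
case/negP: incorrect; apply/andP; split; apply/forallP => v.
  case colv: (col v) (colored v) => [c|] // _.
  by have [] := proper _ _ colv.
apply/forallP => u; apply/implyP => vu.
case colv: (col v) (colored v) => [c|] // _.
by rewrite eq_sym; have [_ ->] := proper _ _ colv.
Qed.

(** Each color that is not free is the color of a neighbor preceding [v], and sortedness bounds the
    rank of that neighbor. Ties are counted as preceding. *)
Lemma card_free_colors (X : 'I_n -> nat) L sel v col :
  let s := order_by X in
  greedy e L sel (take (index v s) s) = Some col ->
  (Delta.+1 <= #|free_colors col v| + #|[set u | e v u & X u <= X v]|)%N.
Proof.
move=> s run; have vs : v \in s by rewrite mem_sort mem_enum.
have := cardsC (free_colors col v); rewrite card_ord => {1}<-; rewrite leq_add2l.
have Some_injective : injective (@Some 'I_Delta.+1) by move=> a b [].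
rewrite -(card_imset _ Some_injective).
apply: leq_trans (leq_imset_card col _); apply/subset_leq_card/subsetP => o.
case/imsetP => c; rewrite !inE negb_forall => /existsP[u].
rewrite negb_imply negbK => /andP[vu /eqP colu] ->; apply/imsetP; exists u => //.
rewrite inE vu /=.
have : isSome (col u) by rewrite colu.
rewrite (greedy_from_dom run) ffunE orbF => us.
have : sorted (fun u v => X u <= X v)%N s.
  by apply: sort_sorted => a b; apply: leq_total.
rewrite sorted_pairwise; last by move=> ? ? ?; apply: leq_trans.
rewrite -(cat_take_drop (index v s) s) pairwise_cat => /andP[/allrelP le _].
by apply: le => //; rewrite (drop_nth v) ?index_mem// nth_index// mem_head.
Qed.

Lemma stuck_disjoint L L' sel s v : {in predC1 v, L =1 L'} ->
  stuck L sel s v =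
  if greedy e L' sel (take (index v s) s) is Some col
  then L v :&: free_colors col v == set0 else false.
Proof.
move=> LL'; rewrite /stuck /greedy (@eq_greedy_from L L'); last first.
  move=> u us; apply: LL'; rewrite inE; apply: contraTneq us => ->.
  by rewrite in_take_leq ?index_size// ltnn.
by case: greedy_from => // col; rewrite usableE.
Qed.

End GreedyRuns.

(** * The program and its output distribution *)

Section Program.

Variable R : realType.

Lemma sampler_forget p s (T : finType) (Q : state -> Prop) :
  (0 < #|T|)%N -> sampler R p s (fun _ : T => Q) -> sampler R p s (fun _ : unit => Q).
Proof.
move=> T0 sp f F fF; rewrite avg_unit -[RHS](avg_const _ T0).
by apply: sp => _ s' /(fF tt).
Qed.

Lemma sampler_seq_unit p1 p2 s (T : finType) Q1 (Q : T -> state -> Prop) :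
  sampler R p1 s (fun _ : unit => Q1) ->
  (forall s1, Q1 s1 -> sampler R p2 s1 Q) -> sampler R (Seq p1 p2) s Q.
Proof.
move=> sp1 sp2 f F fF /=; rewrite -(avg_unit (fun _ => avg F)).
by apply: sp1 => _ s1 /sp2; apply.
Qed.

End Program.

Definition scalar (x : nat) : expr := Read x (Const 0) (Const 0).

(* Arrays 6, 7 and 8 hold the loop counters; [log_loop] puts the bit length  *)
(* [l] of [n] in array 5 and the power [2 ^ l] in array 4.                    *)
Definition log_loop : prog :=
  For 6 (scalar 0)
    (If (Leq (scalar 4) (scalar 0))
      (Seq (Assign 4 (Const 0) (Const 0) (Mul (Const 2) (scalar 4)))
           (Assign 5 (Const 0) (Const 0) (Add (scalar 5) (Const 1))))
      Skip).

Definition log_prog : prog :=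
  Seq (Assign 4 (Const 0) (Const 0) (Const 1)) log_loop.

(** The cell first holds the draw and is then overwritten by the 0/1 membership bit. Adding 1 on the
    left turns [Leq] into the strict test of [in_list]. *)
Definition color_prog (c : nat) : prog :=
  Seq (Rand 3 (scalar 7) (scalar 8) (scalar 1))
    (Assign 3 (scalar 7) (scalar 8)
      (Leq (Add (Mul (Read 3 (scalar 7) (scalar 8))
                     (Defs.Sub (scalar 1) (Read 2 (scalar 7) (Const 0))))
                (Const 1))
           (Mul (Mul (Const c) (scalar 5)) (Add (scalar 1) (Const 1))))).

Definition vertex_prog (c : nat) : prog :=
  Seq (Rand 2 (scalar 7) (Const 0) (scalar 1))
      (For 8 (Add (scalar 1) (Const 1)) (color_prog c)).

Definition list_prog (c : nat) : prog :=
  Seq log_prog (For 7 (scalar 0) (vertex_prog c)).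

Definition draws (Delta : nat) : finType :=
  ('I_Delta.+1 * {ffun 'I_Delta.+1 -> 'I_Delta.+1})%type.

(* With [z] uniform in {0, ..., Delta}, this has probability about            *)
(* [K / (Delta - x)], capped at 1.                                           *)
Definition in_list (K Delta x z : nat) : bool := (z * (Delta - x) < K * Delta.+1)%N.

Definition ready (n Delta l : nat) (s : state) : Prop :=
  [/\ s 0 0 0 = n, s 1 0 0 = Delta & s 5 0 0 = l]%N.

Lemma nth_image_ord (T : Type) (x0 : T) m (f : 'I_m -> T) (i : 'I_m) :
  nth x0 [seq f j | j : 'I_m] i = f i.
Proof. by rewrite (nth_map i) ?size_enum_ord// nth_ord_enum. Qed.

Section ProgramSpec.

Variable R : realType.

Lemma log_prog_spec n Delta :
  sampler R log_prog (input n Delta) (fun _ : unit => ready n Delta (up_log 2 n.+1)).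
Proof.
(* Either the power of two already exceeds [n], or every iteration so far has doubled it; [n]
   iterations suffice because n < 2 ^ n. *)
pose J (w : seq unit) (s : state) := [/\ s 0 0 0 = n, s 1 0 0 = Delta,
  s 4 0 0 = 2 ^ s 5 0 0, s 5 0 0 <= up_log 2 n.+1 &
  (n < s 4 0 0) || (s 5 0 0 == size w)]%N.
suff spec : sampler R log_loop (store (input n Delta) 4 0 0 1)
    (fun _ : unit => ready n Delta (up_log 2 n.+1)) by move=> f F fF; apply: spec.
apply: (@sampler_forget _ _ _ {ffun 'I_n -> unit}).
  by rewrite card_ffun card_unit exp1n.
apply: (@sampler_weaken _ _ _ _ (fun w : {ffun 'I_n -> unit} => J [seq w i | i : 'I_n])).
  apply: sampler_for => [//||w s sw [sn sD s4 s5 sl] f' F' fF'].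
    by split=> //; rewrite /store /= orbT.
  rewrite avg_unit /=; rewrite /= /store/= s4 sn.
  case: (leqP (2 ^ s 5 0 0) n)%N => /= sle; apply: fF'; split; rewrite /store //=.
  - by rewrite addn1 expnS.
  - rewrite addn1 ltnNge; apply/negP => le; move: sle; rewrite leqNgt => /negP[].
    by rewrite (leq_trans (up_logP n.+1 (leqnn 2)))// leq_exp2l.
  - rewrite size_rcons addn1 eqSS; case/orP: sl => [|->]; last by rewrite orbT.
    by rewrite s4 ltnNge sle.
  - by rewrite s4 sle.
move=> w s [sn sD s4 s5 sl]; split => //; apply/eqP; rewrite eqn_leq s5 /=.
apply: up_log_min => //; rewrite -s4; case/orP: sl => // /eqP.
by rewrite size_map size_enum_ord s4 => ->; rewrite ltn_expl.
Qed.

Lemma vertex_prog_spec c n Delta l s v :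
  ready n Delta l s -> s 7 0 0 = v ->
  sampler R (vertex_prog c) s (fun (t : draws Delta) s' =>
    [/\ ready n Delta l s',
        forall u, u != v -> s' 2 u 0 = s 2 u 0 /\ s' 3 u =1 s 3 u,
        s' 2 v 0 = t.1 &
        forall d : 'I_Delta.+1, s' 3 v d = in_list (c * l) Delta t.1 (t.2 d)])%N.
Proof.
move=> [s0 s1 s5] s7; apply: sampler_seq; first exact: (@sampler_rand _ _ _ _ _ _ Delta).
move=> x s' ->; rewrite /= s7; set s'' := store _ _ _ _ _.
pose J (w : seq 'I_Delta.+1) (t : state) := [/\ ready n Delta l t,
  t 7 0 0 = v, (forall u, t 2 u 0 = s'' 2 u 0),
  (forall u, u != v -> t 3 u =1 s 3 u) &
  forall d, (d < size w)%N -> t 3 v d = in_list (c * l) Delta x (nth ord0 w d)]%N.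
apply: (@sampler_weaken _ _ _ _
  (fun z : {ffun 'I_Delta.+1 -> 'I_Delta.+1} => J [seq z i | i : 'I_Delta.+1])); last first.
  move=> z t [tr t7 t2 t3 tl]; split=> // [u uv||d].
  - by split; [rewrite t2 /s'' /store/= (negPf uv) | apply: t3].
  - by rewrite t2 /s'' /store /= !eqxx.
  - rewrite tl ?nth_image_ord// size_image card_ord//.
apply: sampler_for.
- by rewrite /s'' /store/= s1 addn1.
- by split=> //; split.
move=> w t sw [[t0 t1 t5] t7 t2 t3 tl].
apply: sampler_assign; first exact: (@sampler_rand _ _ _ _ _ _ Delta).
move=> k t' ->; have t2v : t 2%N v 0%N = x by rewrite t2 /s'' /store /= !eqxx.
split; rewrite /store /= ?t7 ?t1 ?t5 ?t2v ?eqxx //=.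
  by move=> u uv d; rewrite (negPf uv) /= t3.
move=> d; rewrite size_rcons ltnS leq_eqVlt nth_rcons.
case: ltngtP => //= [dw _|_ _]; first exact: tl.
by rewrite /in_list !addn1.
Qed.

Lemma list_prog_spec c n Delta :
  sampler R (list_prog c) (input n Delta) (fun (w : {ffun 'I_n -> draws Delta}) s =>
    forall v : 'I_n, s 2 v 0 = (w v).1 /\ forall d : 'I_Delta.+1,
      s 3 v d = in_list (c * up_log 2 n.+1) Delta (w v).1 ((w v).2 d))%N.
Proof.
apply: sampler_seq_unit; first exact: log_prog_spec.
move=> s sready; set l := up_log 2 n.+1 in sready *.
pose t0 : draws Delta := (ord0, [ffun=> ord0]).
pose J (w : seq (draws Delta)) (s : state) := ready n Delta l s /\
  forall v, (v < size w)%N -> (s 2 v 0 = (nth t0 w v).1 /\ forall d : 'I_Delta.+1,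
      s 3 v d = in_list (c * l) Delta (nth t0 w v).1 ((nth t0 w v).2 d))%N.
apply: (@sampler_weaken _ _ _ _
  (fun w : {ffun 'I_n -> draws Delta} => J [seq w i | i : 'I_n])); last first.
  move=> w t [_ Jt] v; have := Jt v; rewrite nth_image_ord; apply.
  by rewrite size_image card_ord.
apply: sampler_for => //; first by case: sready.
move=> w t _ [tready tw]; apply: sampler_weaken.
  by apply: (@vertex_prog_spec c n Delta l _ (size w)) => //; case: tready.
move=> x t' [t'ready t'u t'2 t'3]; split=> // v.
rewrite size_rcons ltnS leq_eqVlt nth_rcons.
case: ltngtP => //= [vw _|-> _]; last by split.
have [] := t'u v; first by rewrite neq_ltn vw.
rewrite /store /= => -> v3; have [-> tv3] := tw v vw; split=> // d.
by rewrite v3 /= tv3.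
Qed.

Definition rank n Delta (w : {ffun 'I_n -> draws Delta}) (v : 'I_n) : nat :=
  (w v).1.

Definition lists K n Delta (w : {ffun 'I_n -> draws Delta}) (v : 'I_n) :
    {set 'I_Delta.+1} :=
  [set d : 'I_Delta.+1 | in_list K Delta (w v).1 ((w v).2 d)].

Lemma expectation_list_prog c n Delta
    (F : ('I_n -> nat) -> ('I_n -> {set 'I_Delta.+1}) -> R) :
  expectation (list_prog c) n Delta (fun s => F (outX s) (outL Delta s)) =
  avg (fun w => F (rank w) (lists (c * up_log 2 n.+1) w)).
Proof.
apply: list_prog_spec => w s sw; congr F; apply/funext => v.
  by have [] := sw v.
apply/setP => d; rewrite !inE; have [_ ->] := sw v.
by case: in_list.
Qed.

End ProgramSpec.

(** * Expected list size *)

Lemma card_ord_ltn N B : #|[set z : 'I_N | (z < B)%N]| = minn N B.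
Proof.
rewrite -sum1dep_card; case: (leqP N B) => NB.
  rewrite (eq_bigl xpredT) ?sum1_card ?card_ord// => z.
  by rewrite (leq_trans (ltn_ord z) NB).
by rewrite -(big_ord_widen_cond _ xpredT (fun=> 1%N) (ltnW NB)) sum1_card card_ord.
Qed.

Section ListSize.

Variables (R : realType) (K Delta : nat).
Hypothesis K_gt0 : (0 < K)%N.

Let N := Delta.+1.

Definition color_prob (x : nat) : R :=
  avg (fun z : 'I_Delta.+1 => (in_list K Delta x z)%:R).

Lemma color_prob_ge0 x : 0 <= color_prob x.
Proof. by apply: avg_ge0 => z; rewrite ler0n. Qed.

Lemma color_prob_le1 x : color_prob x <= 1.
Proof. by apply: avg_le_const => [|z]; rewrite ?card_ord ?lern1 ?leq_b1. Qed.

Lemma in_listE x z : (0 < Delta - x)%N ->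
  in_list K Delta x z = (z < ((K * N).-1 %/ (Delta - x)).+1)%N.
Proof. by move=> r0; rewrite ltnS leq_divRL// -ltnS prednK// muln_gt0 K_gt0. Qed.

Lemma color_prob_rank0 x : (Delta - x = 0)%N -> color_prob x = 1.
Proof.
move=> r0; rewrite /color_prob -[RHS](@avg_const _ 'I_Delta.+1) ?card_ord//.
by apply: eq_avg => z; rewrite /in_list r0 muln0 muln_gt0 K_gt0.
Qed.

Lemma color_probE x : (0 < Delta - x)%N ->
  color_prob x = (minn N ((K * N).-1 %/ (Delta - x)).+1)%:R / N%:R.
Proof.
move=> r0; rewrite /color_prob avg_indicator card_ord -card_ord_ltn.
by congr (_%:R / _); apply: eq_card => z; rewrite !inE in_listE.
Qed.

(** The number of accepted draws is the ceiling of K N / (Delta - x), capped at N; rounding up gives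
    this bound unless the cap is reached. *)
Lemma color_prob_lb x : color_prob x = 1 \/ K%:R <= color_prob x * (Delta - x)%:R.
Proof.
have [r0|r0] := posnP (Delta - x)%N; first by left; apply: color_prob_rank0.
rewrite color_probE//; case: leqP => NB; first by left; rewrite divff// pnatr_eq0.
right; rewrite mulrAC ler_pdivlMr ?ltr0n// -!natrM ler_nat.
by rewrite -[leqLHS]prednK ?muln_gt0 ?K_gt0// ltn_ceil.
Qed.

Lemma color_prob_ub x : (0 < Delta - x)%N ->
  color_prob x <= K%:R / (Delta - x)%:R + N%:R^-1.
Proof.
move=> r0; rewrite color_probE// ler_pdivrMr ?ltr0n// mulrDl mulVf ?pnatr_eq0//.
rewrite mulrAC (@le_trans _ _ ((K * N).-1 %/ (Delta - x)).+1%:R) ?ler_nat ?geq_minr//.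
rewrite -natr1 lerD2r ler_pdivlMr ?ltr0n// -!natrM ler_nat.
by rewrite (leq_trans (leq_trunc_div _ _))// leq_pred.
Qed.

Lemma harmonic_le m : \sum_(i < m.+1) i.+1%:R^-1 <= 1 + ln m.+1%:R :> R.
Proof.
elim: m => [|m IHm]; first by rewrite big_ord1 ln1 invr1 addr0.
rewrite big_ord_recr /=.
(* The logarithm increment is minus ln (1 - 1 / (m + 2)), and ln (1 + y) <= y. *)
have step : m.+2%:R^-1 <= ln m.+2%:R - ln m.+1%:R :> R.
  have -> : ln m.+1%:R = ln m.+2%:R + ln (1 + - m.+2%:R^-1) :> R.
    rewrite -lnM ?posrE ?ltr0n//; last first.
      by rewrite subr_gt0 invf_lt1 ?ltr0n// ltr1n.
    by rewrite mulrDr mulr1 mulrN divff ?pnatr_eq0// -[m.+2%:R]natr1 addrK.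
  rewrite opprD addNKr lerNr le_ln1Dx// ltrN2 invf_lt1 ?ltr0n// ltr1n//.
by apply: le_trans (lerD IHm step) _; rewrite -addrA subrKC.
Qed.

Lemma sum_color_prob_le : (0 < Delta)%N ->
  \sum_(x < N) color_prob x <= 2 + K%:R * (1 + ln Delta%:R).
Proof.
move=> D0; rewrite (reindex_inj rev_ord_inj) big_ord_recl /=.
apply: le_trans (_ : 1 + \sum_(i < Delta) (K%:R * i.+1%:R^-1 + N%:R^-1) <= _).
  apply: lerD; first exact: color_prob_le1.
  apply: ler_sum => i _; have iD := ltn_ord i.
  have -> : (Delta.+1 - (bump 0 i).+1 = Delta - i.+1)%N by rewrite subSS.
  have E : (Delta - (Delta - i.+1) = i.+1)%N by rewrite subKn.
  by have := @color_prob_ub (Delta - i.+1); rewrite E; apply.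
rewrite big_split /= -mulr_sumr sumr_const card_ord.
rewrite -[2]/(1 + 1) -addrA lerD2l addrC; apply: lerD.
  by rewrite -[leLHS]mulr_natr mulrC ler_pdivrMr ?ltr0n// mul1r ler_nat.
rewrite ler_wpM2l//; case: Delta D0 => // m _; exact: harmonic_le.
Qed.

End ListSize.

(** * Mean and concentration of the average list size *)

Section Randomness.

Variables (R : realType) (K n Delta : nat).
Hypothesis K_gt0 : (0 < K)%N.

Let N := Delta.+1.
Implicit Types (w : {ffun 'I_n -> draws Delta}) (t : draws Delta).

Lemma card_draws_gt0 : (0 < #|draws Delta|)%N.
Proof. by rewrite card_prod card_ffun card_ord muln_gt0 expn_gt0. Qed.

Lemma card_outcomes_gt0 : (0 < #|{ffun 'I_n -> draws Delta}|)%N.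
Proof. by rewrite card_ffun expn_gt0 card_draws_gt0. Qed.

Definition list_size t : nat :=
  #|[set d : 'I_Delta.+1 | in_list K Delta t.1 (t.2 d)]|.

Lemma list_size_le t : (list_size t <= N)%N.
Proof. by rewrite -[N]card_ord max_card. Qed.

Lemma avg_list_size :
  avg (fun t => (list_size t)%:R) = \sum_(x < N) color_prob R K Delta x.
Proof.
have sizeE t : (list_size t)%:R =
    \sum_(d < N) (in_list K Delta t.1 (t.2 d))%:R :> R.
  rewrite /list_size -sum1dep_card natr_sum big_mkcond.
  by apply: eq_bigr => d _; case: in_list.
rewrite (eq_avg sizeE) avg_sum.
rewrite (eq_bigr (fun _ => avg (fun x : 'I_Delta.+1 => color_prob R K Delta x))).
  rewrite sumr_const card_ord /avg card_ord -[LHS]mulr_natr mulfVK//.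
  by rewrite pnatr_eq0.
move=> d _; rewrite avg_pair; apply: eq_avg => x /=.
apply: (@avg_coord _ _ _ d (fun z : 'I_Delta.+1 => (in_list K Delta x z)%:R)).
by rewrite card_ord.
Qed.

Lemma avg_sizeE w : avg_size R (lists K w) = (\sum_v (list_size (w v))%:R) / n%:R.
Proof. by []. Qed.

Lemma avg_avg_size : (0 < n)%N ->
  avg (fun w => avg_size R (lists K w)) = \sum_(x < N) color_prob R K Delta x.
Proof.
move=> n0; under eq_avg do rewrite avg_sizeE mulrC.
rewrite avgZ avg_sum (eq_bigr (fun _ => avg (fun t => (list_size t)%:R))).
  rewrite sumr_const card_ord -[X in _^-1 * X]mulr_natl mulKf ?avg_list_size//.
  by rewrite pnatr_eq0 -lt0n.
by move=> v _; apply: (@avg_coord _ _ _ v (fun t => (list_size t)%:R)) card_draws_gt0.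
Qed.

(** From 1 - y <= exp (- y) follows exp y <= 1 + y exp y, and exp y <= e on [0, 1]. *)
Lemma expR_le_chord (y : R) : 0 <= y -> y <= 1 -> expR y <= 1 + expR 1 * y.
Proof.
move=> y0 y1; have le1 : expR y * (1 - y) <= 1.
  rewrite -[leRHS](expRxMexpNx_1 y) ler_wpM2l ?expR_ge0//.
  exact: expR_ge1Dx.
have le2 : expR y * y <= expR 1 * y by rewrite ler_wpM2r// ler_expR.
by move: le1; rewrite mulrBr mulr1 lerBlDr => /le_trans; apply; rewrite lerD2l.
Qed.

(* Chernoff: the moment generating function of the sizes, scaled by [N] so    *)
(* that they lie in [0, 1].                                                   *)
Lemma avg_size_tail (mu M b : R) : (Delta < n)%N ->
  \sum_(x < N) color_prob R K Delta x <= mu -> b <= M - expR 1 * mu -> 0 <= b ->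
  avg (fun w => (M < avg_size R (lists K w))%R%:R) <= expR (- b) :> R.
Proof.
move=> Dn mean_le bM b0; have n0 : (0 < n)%N by apply: leq_trans Dn.
have nN : 0 < n%:R :> R by rewrite ltr0n.
have NN : 0 < N%:R :> R by rewrite ltr0n.
have mgf : avg (fun t => expR ((list_size t)%:R / N%:R)) <= expR (expR 1 * mu / N%:R).
  apply: le_trans (expR_ge1Dx _).
  apply: le_trans (_ : avg (fun t => 1 + expR 1 / N%:R * (list_size t)%:R) <= _).
    apply: ler_avg => t; apply: le_trans (expR_le_chord _ _) _.
    - by rewrite divr_ge0.
    - by rewrite ler_pdivrMr// mul1r ler_nat list_size_le.
    - by rewrite mulrA mulrAC.
  under eq_avg do rewrite -[1]opprK addrC.
  rewrite avgB avgZ avg_const ?card_draws_gt0// opprK addrC lerD2l avg_list_size.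
  by rewrite mulrAC ler_pM2r ?invr_gt0// ler_pM2l ?expR_gt0.
(* Markov's inequality in exponential form; the product over vertices then factors by
   independence. *)
apply: le_trans (_ : avg (fun w => expR (- (n%:R * M / N%:R)) *
    \prod_v expR ((list_size (w v))%:R / N%:R)) <= _).
  apply: ler_avg => w; case: ltP => [Mlt|_]; last first.
    by rewrite mulr_ge0 ?expR_ge0// prodr_ge0// => v _; rewrite expR_ge0.
  rewrite -expR_sum -expRD -mulr_suml -mulNr -mulrDl.
  apply: le_trans (expR_ge1Dx _); rewrite lerDl divr_ge0// addrC subr_ge0.
  by move: Mlt; rewrite avg_sizeE ltr_pdivlMr// mulrC => /ltW.
rewrite avgZ (avg_ffun_prod (fun=> fun t => expR ((list_size t)%:R / N%:R))).
rewrite prodr_const card_ord.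
apply: le_trans (_ : expR (- (n%:R * M / N%:R)) * expR (expR 1 * mu / N%:R) ^+ n <= _).
  rewrite ler_pM2l ?expR_gt0// lerXn2r ?nnegrE ?expR_ge0//.
  by apply: avg_ge0 => t; rewrite expR_ge0.
rewrite -expRM_natl -expRD ler_expR.
(* The scaling costs nothing: n / N >= 1 since Delta < n. *)
rewrite (_ : _ + _ = - (n%:R / N%:R * (M - expR 1 * mu))); last first.
  by field; rewrite ?pnatr_eq0.
rewrite lerN2 (le_trans bM)// ler_peMl ?(le_trans b0)// ler_pdivlMr// mul1r.
by rewrite ler_nat.
Qed.

End Randomness.

(** * Probability that greedy gets stuck at a given vertex *)

Section FailureProbability.

Variables (R : realType) (K n Delta : nat) (e : rel 'I_n).
Variable sel : choice_rule n Delta.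
Hypotheses (K_gt0 : (0 < K)%N) (e_irr : irreflexive e).
Hypothesis e_deg : (max_degree e <= Delta)%N.

Let N := Delta.+1.
Let miss (x : nat) : R := 1 - color_prob R K Delta x.
Implicit Types (w : {ffun 'I_n -> draws Delta}) (v : 'I_n) (x : 'I_Delta.+1).

Let degree v := #|[set u | e v u]|.

Let miss_ge0 x : 0 <= miss x.
Proof. by rewrite subr_ge0 color_prob_le1. Qed.

Let miss_le1 x : miss x <= 1.
Proof. by rewrite lerBlDr lerDl color_prob_ge0. Qed.

Let degree_le v : (degree v <= Delta)%N.
Proof. exact: leq_trans (leq_bigmax v) e_deg. Qed.

Lemma avg_avoid x (U : {set 'I_Delta.+1}) :
  avg (fun z : {ffun 'I_Delta.+1 -> 'I_Delta.+1} =>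
    ([set d : 'I_Delta.+1 | in_list K Delta x (z d)] :&: U == set0)%:R)
  = miss x ^+ #|U|.
Proof.
pose g (d z : 'I_Delta.+1) : R :=
  if d \in U then 1 - (in_list K Delta x z)%:R else 1.
have -> : miss x ^+ #|U| = \prod_d avg (g d).
  rewrite -prodr_const big_mkcond; apply: eq_bigr => d _; rewrite /g.
  case: ifP => _; last by rewrite avg_const ?card_ord.
  by rewrite avgB avg_const ?card_ord.
rewrite -avg_ffun_prod; apply: eq_avg => z.
have [/eqP LU|/set0Pn[d]] := boolP (_ == set0).
  rewrite big1 // => d _; rewrite /g; case: ifP => // dU.
  have /setP/(_ d) := LU; rewrite !inE dU andbT => ->.
  by rewrite subr0.
rewrite !inE => /andP[dL dU]; rewrite (bigD1 d)//= /g dU dL subrr mul0r//.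
Qed.

Lemma avg_stuck_rank w v x :
  avg (fun z => (stuck e (lists K (update w v (x, z))) sel
                  (order_by (rank (update w v (x, z)))) v)%:R) <=
  miss x ^+ (N - degree v) *
    \prod_u (if e v u && (x < (w u).1)%N then miss x else 1).
Proof.
(* A reference outcome with arbitrary list draws at [v]: the ranks and the run before [v] are the
   same for every [z]. *)
set w0 := update w v (x, [ffun=> ord0]).
have rankE z : rank (update w v (x, z)) = rank w0.
  by apply/funext => u; rewrite /rank !ffunE; case: eqP.
have listsE z : {in predC1 v, lists K (update w v (x, z)) =1 lists K w0}.
  by move=> u; rewrite inE => uv; apply/setP => d; rewrite !inE !ffunE (negPf uv).
under eq_avg do rewrite rankE (stuck_disjoint _ _ _ (listsE _)).
case run: greedy => [col|]; last first.
  rewrite avg_const ?card_ffun ?card_ord ?expn_gt0// mulr_ge0 ?exprn_ge0//.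
  by rewrite prodr_ge0// => u _; case: ifP.
apply: le_trans (_ : avg (fun z : {ffun 'I_Delta.+1 -> 'I_Delta.+1} =>
    ([set d : 'I_Delta.+1 | in_list K Delta x (z d)] :&: free_colors e col v
       == set0)%:R) <= _).
  apply: ler_avg => z; rewrite ler_nat; apply: eq_leq; congr (nat_of_bool (_ :&: _ == _)).
  by apply/setP => d; rewrite !inE !ffunE eqxx.
rewrite avg_avoid.
(* The power is kept as a product over neighbors so that their ranks can later be averaged
   independently. *)
have -> : \prod_u (if e v u && (x < (w u).1)%N then miss x else 1) =
    miss x ^+ #|[set u | e v u & (x < (w u).1)%N]|.
  by rewrite -prodr_const [RHS]big_mkcond; apply: eq_bigr => u _; rewrite inE.
rewrite -exprD ler_wiXn2l//.
have rank0 u : e v u -> rank w0 u = (w u).1.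
  by move=> vu; rewrite /rank ffunE; case: eqP vu => // ->; rewrite e_irr.
have := card_free_colors run; have -> : rank w0 v = x by rewrite /rank ffunE eqxx.
have degE : degree v = (#|[set u | e v u & (rank w0 u <= x)%N]| +
    #|[set u | e v u & (x < (w u).1)%N]|)%N.
  rewrite /degree -(cardsID [set u | (rank w0 u <= x)%N] [set u | e v u]).
  congr (_ + _)%N.
    by apply: eq_card => u; rewrite !inE.
  apply: eq_card => u; rewrite !inE andbC -ltnNge.
  by case vu: (e v u) => //=; rewrite rank0.
have := degree_le v; rewrite /N; lia.
Qed.

Lemma avg_failure v :
  avg (fun w => (stuck e (lists K w) sel (order_by (rank w)) v)%:R) <=
  expR (- K%:R) :> R.
Proof.
rewrite (avg_update v) ?card_draws_gt0//.
apply: le_trans (_ : avg (fun w => avg (fun x : 'I_Delta.+1 =>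
    miss x ^+ (N - degree v) *
    \prod_u (if e v u && (x < (w u).1)%N then miss x else 1))) <= _).
  apply: ler_avg => w; rewrite avg_pair; apply: ler_avg => x; exact: avg_stuck_rank.
rewrite exchange_avg; apply: avg_le_const => [|x]; first by rewrite card_ord.
rewrite avgZ (avg_ffun_prod (fun u (t : draws Delta) =>
  if e v u && (x < t.1)%N then miss x else 1)).
set q : R := (Delta - x)%:R / N%:R; set p := color_prob R K Delta x.
have factorE u :
    avg (fun t : draws Delta => if e v u && (x < t.1)%N then miss x else 1) =
    if e v u then 1 - p * q else 1.
  case: ifP => vu; last by rewrite avg_const ?card_draws_gt0.
  rewrite (avg_fst (fun y : 'I_Delta.+1 => if true && (x < y)%N then miss x else 1)).
    rewrite (@eq_avg _ _ _ (fun y : 'I_Delta.+1 => 1 - p * (x < y)%N%:R)); last first.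
      by move=> y; rewrite andTb; case: ltnP => _; rewrite ?mulr1 ?mulr0 ?subr0.
    rewrite (avgB (fun=> 1)) avgZ avg_const ?card_ord// avg_indicator card_ord.
    suff -> : #|[set y : 'I_N | (x < y)%N]| = (Delta - x)%N by [].
    have := cardsC [set y : 'I_N | (y < x.+1)%N]; rewrite card_ord_ltn card_ord.
    rewrite (minn_idPr (ltn_ord x)) => cardE.
    have -> : (Delta - x)%N = #|~: [set y : 'I_N | (y < x.+1)%N]|.
      by move: cardE; rewrite /N; lia.
    by apply: eq_card => y; rewrite !inE -leqNgt.
  by rewrite card_ffun card_ord expn_gt0.
rewrite (eq_bigr _ (fun u _ => factorE u)) -big_mkcond prodr_const.
have -> : #|[pred u | e v u]| = degree v by apply: eq_card => u; rewrite !inE.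
have p0 : 0 <= p := color_prob_ge0 _ _ _ _.
have p1 : p <= 1 := color_prob_le1 _ _ _ _.
have q0 : 0 <= q by rewrite divr_ge0.
have q1 : q <= 1 by rewrite ler_pdivrMr ?ltr0n// mul1r ler_nat; lia.
have pq1 : p * q <= p by rewrite ler_piMr.
have [p_eq1|pK] := color_prob_lb R Delta K_gt0 x.
  (* With p = 1 the bound vanishes, since the exponent N - degree v is positive. *)
  rewrite /miss p_eq1 subrr expr0n; have := degree_le v.
  case: (N - degree v)%N (subn_gt0 (degree v) N) => [|m _ _]; first by lia.
  by rewrite mul0r expR_ge0.
(* As q <= 1, each factor 1 - p is at most 1 - p q, so all N factors become equal. *)
apply: le_trans (_ : (1 - p * q) ^+ N <= _).
  rewrite -[X in _ <= _ ^+ X](subnK (leqW (degree_le v))) exprD.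
  rewrite ler_wpM2r ?exprn_ge0 ?subr_ge0 ?(le_trans pq1)//.
  by rewrite lerXn2r ?nnegrE ?subr_ge0 ?(le_trans pq1)// /miss lerD2l lerN2.
apply: le_trans (_ : expR (- (p * q)) ^+ N <= _).
  by rewrite lerXn2r ?nnegrE ?subr_ge0 ?(le_trans pq1) ?expR_ge0 ?expR_ge1Dx.
rewrite -expRM_natl ler_expR mulrN lerN2 (le_trans pK)//.
by rewrite mulrCA /q [N%:R * _]mulrC mulfVK// pnatr_eq0.
Qed.

End FailureProbability.

(** * Bit length versus natural logarithm *)

Section Logarithms.

Variable R : realType.

Lemma ln2_gt0 : 0 < ln 2 :> R.
Proof. by rewrite ln_gt0// ltr1n. Qed.

Lemma le_ln_nat (m k : nat) :
  (0 < m)%N -> (m <= k)%N -> ln m%:R <= ln k%:R :> R.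
Proof. by move=> m0 mk; rewrite ler_ln ?posrE ?ltr0n ?ler_nat// (leq_trans m0). Qed.

Lemma ln_le_up_log n : (0 < n)%N -> ln n%:R <= (up_log 2 n.+1)%:R :> R.
Proof.
move=> n0; apply: le_trans (_ : ln (2 ^ up_log 2 n.+1)%:R <= _).
  by apply: le_ln_nat => //; apply: ltnW; apply: up_logP.
rewrite natrX lnXn// -[leLHS]mulr_natl ler_piMr//.
by have := @le_ln1Dx R 1; apply; rewrite (lt_trans (ltrN10 R)).
Qed.

(** For bit length l, 2 ^ (l - 1) <= n and 2 <= n give 2 ^ l <= n ^ 2. *)
Lemma up_log_le_ln n : (1 < n)%N ->
  (up_log 2 n.+1)%:R <= 2 / ln 2 * ln n%:R :> R.
Proof.
move=> n1; rewrite mulrAC ler_pdivlMr ?ln2_gt0// !mulr_natl.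
rewrite -!lnXn ?ltr0n//; last first.
  by rewrite (leq_trans _ n1).
rewrite -!natrX; apply: le_ln_nat; first by rewrite expn_gt0.
have /andP[lt _] := @up_log_bounds 2 n.+1 isT (leqW n1).
have l0 : (0 < up_log 2 n.+1)%N by rewrite up_log_gt0 (leqW n1).
by rewrite -(prednK l0) expnS -mulnn leq_mul.
Qed.

End Logarithms.

(** * Union bound and choice of constants *)

Lemma max_degree_ltn n (e : rel 'I_n) :
  irreflexive e -> (0 < n)%N -> (max_degree e < n)%N.
Proof.
move=> e_irr n0; rewrite -[ltnRHS](prednK n0) ltnS; apply/bigmax_leqP => v _.
rewrite -ltnS prednK// -[ltnRHS]card_ord -[ltnRHS]cardsT; apply: proper_card.
by apply/properP; split; [apply: subsetT | exists v; rewrite !inE ?e_irr].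
Qed.

Lemma avg_failures (R : realType) n Delta (e : rel 'I_n)
    (sel : choice_rule n Delta) K :
  symmetric e -> irreflexive e -> (max_degree e <= Delta)%N -> valid_rule sel ->
  (0 < n -> 0 < K)%N ->
  1 - n%:R * expR (- K%:R) <=
    avg (fun w => (greedy_correct e (lists K w) sel (order_by (rank w)))%:R) :> R.
Proof.
move=> esym eirr edeg valid K0.
have -> : n%:R * expR (- K%:R) = \sum_(v < n) expR (- K%:R) :> R.
  by rewrite sumr_const card_ord mulr_natl.
apply: le_trans (_ : 1 - \sum_(v < n)
   avg (fun w => (stuck e (lists K w) sel (order_by (rank w)) v)%:R) <= _).
  rewrite lerD2l lerN2; apply: ler_sum => v _; apply: avg_failure => //.
  by apply: K0; apply: leq_trans (ltn_ord v).
rewrite -avg_sum -[X in X - _ <= _](@avg_const _ {ffun 'I_n -> draws Delta})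
  ?card_outcomes_gt0//.
rewrite -avgB; apply: ler_avg => w /=; rewrite lerBlDr.
have [_|incorrect] := boolP (greedy_correct _ _ _ _).
  by rewrite lerDl sumr_ge0.
rewrite add0r; have uniq_order : uniq (order_by (rank w)).
  by rewrite sort_uniq enum_uniq.
have mem_order v : v \in order_by (rank w) by rewrite mem_sort mem_enum.
have := greedy_incorrect_stuck esym eirr valid uniq_order mem_order incorrect.
by case/existsP => v stuckv; rewrite (bigD1 v)//= stuckv lerDl sumr_ge0.
Qed.

Theorem theorem1p1 (R : realType) (c : nat) :
  exists (A : prog) (C : R), forall (n Delta : nat) (e : rel 'I_n),
    symmetric e -> irreflexive e -> max_degree e = Delta ->
    [/\ forall sel : choice_rule n Delta, valid_rule sel ->
          1 - n%:R ^- c <=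
          probability R A n Delta (fun s =>
            greedy_correct e (outL Delta s) sel (order_by (outX s))),
        (2 <= Delta)%N ->
          expectation A n Delta (fun s => avg_size R (outL (n := n) Delta s))
          <= C * (ln n%:R * ln Delta%:R)
      & (2 <= Delta)%N ->
          1 - n%:R ^- c <=
          probability R A n Delta (fun s =>
            avg_size R (outL (n := n) Delta s)
            <= C * (ln n%:R * ln Delta%:R))].
Proof.
(* For m >= 2, a ln m >= 1, which absorbs constants: 2 <= 2 (a ln n) (a ln Delta), 1 + ln Delta <=
   (a + 1) ln Delta, and K <= 2 (c + 1) a ln n. So [C0] bounds the mean. In [C], the factor e is the
   loss in the Chernoff bound and c a leaves a margin of at least c ln n. *)
pose a : R := (ln 2)^-1; pose C0 : R := 2 * a ^+ 2 + 2 * c.+1%:R * a * (a + 1).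
pose C : R := expR 1 * C0 + c%:R * a.
(* The exponent c + 1 pays for the factor n of the union bound. *)
exists (list_prog c.+1), C => n Delta e esym eirr edeg.
set l := up_log 2 n.+1; set K := (c.+1 * l)%N.
have K0 : (0 < n -> 0 < K)%N by move=> n0; rewrite muln_gt0 up_log_gt0.
have a0 : 0 < a by rewrite invr_gt0 ln2_gt0.
have C0_ge0 : 0 <= C0.
  by rewrite addr_ge0 ?mulr_ge0 ?addr_ge0 ?exprn_ge0 ?(ltW a0).
have expRN m : (0 < n)%N -> expR (- (m%:R * ln n%:R)) = n%:R ^- m :> R.
  by move=> n0; rewrite -mulrN expRM_natl expRN lnK ?posrE ?ltr0n// exprVn.
have large : (2 <= Delta)%N ->
  [/\ (Delta < n)%N, 1 <= a * ln Delta%:R, 1 <= a * ln n%:R &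
    \sum_(x < Delta.+1) color_prob R K Delta x <= C0 * (ln n%:R * ln Delta%:R)].
  move=> D2; have n0 : (0 < n)%N.
    by case: n e edeg {esym eirr l K K0 expRN} => // e; rewrite /max_degree big_ord0; lia.
  have Dn : (Delta < n)%N by rewrite -edeg max_degree_ltn.
  have aD : 1 <= a * ln Delta%:R.
    by rewrite mulrC ler_pdivlMr ?ln2_gt0// mul1r le_ln_nat.
  have an : 1 <= a * ln n%:R.
    by apply: (le_trans aD); rewrite ler_pM2l// le_ln_nat//; lia.
  split=> //; apply: le_trans (sum_color_prob_le _ (K0 n0) _) _; first by lia.
  have Kle : K%:R <= c.+1%:R * (2 * a * ln n%:R) :> R.
    by rewrite natrM ler_wpM2l// up_log_le_ln//; lia.
  have c0 : 0 <= c.+1%:R :> R by [].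
  set x := ln n%:R in an Kle *; set y := ln Delta%:R in aD *.
  have y1 : 1 + y <= (a + 1) * y by lra.
  have : 1 <= (a * x) * (a * y) by rewrite -[1]mul1r ler_pM.
  have : K%:R * (1 + y) <= c.+1%:R * (2 * a * x) * ((a + 1) * y).
    by apply: ler_pM => //; rewrite addr_ge0// ln_ge0// ler1n; lia.
  rewrite /C0; move: (c.+1%:R) c0 => k k0; nra.
split.
- move=> sel valid.
  rewrite /probability (expectation_list_prog _
    (fun X L => (greedy_correct e L sel (order_by X))%:R)).
  apply: le_trans (avg_failures _ _ _ _ _ K0); rewrite ?edeg//.
  rewrite lerD2l lerN2; have [->|n0] := posnP n.
    by rewrite mul0r invr_ge0 exprn_ge0.
  apply: le_trans (_ : n%:R * n%:R ^- c.+1 <= _); last first.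
    by rewrite exprS invfM mulrA divff ?mul1r// pnatr_eq0 -lt0n.
  rewrite ler_wpM2l// -expRN// ler_expR lerN2 natrM ler_wpM2l//.
  exact: ln_le_up_log.
- move=> D2; have [Dn aD an mean] := large D2.
  rewrite (expectation_list_prog _ (fun X L => avg_size R L)).
  rewrite avg_avg_size; last by lia.
  apply: (le_trans mean); rewrite ler_wpM2r//.
    by rewrite mulr_ge0 ?ln_ge0 ?ler1n//; lia.
  rewrite -[leLHS]addr0 lerD ?mulr_ge0 ?(ltW a0)//.
  rewrite ler_peMl// (le_trans _ (expR_ge1Dx _))//.
  by rewrite lerDl.
- move=> D2; have [Dn aD an mean] := large D2.
  set M := C * _.
  rewrite /probability (expectation_list_prog _
    (fun X L => (avg_size R L <= M)%R%:R)).
  have n0 : (0 < n)%N by lia.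
  have x0 : 0 <= ln n%:R :> R by rewrite ln_ge0// ler1n.
  have := @avg_size_tail R K n Delta _ M (c%:R * ln n%:R) Dn mean.
  rewrite expRN// -/K => tail.
  apply: le_trans (_ : 1 - avg (fun w : {ffun 'I_n -> draws Delta} =>
      (M < avg_size R (lists K w))%R%:R) <= _).
    rewrite lerD2l lerN2 tail ?mulr_ge0//.
    rewrite /M /C; set x := ln n%:R in x0 *; set y := ln Delta%:R in aD *.
    rewrite mulrDl -[expR 1 * C0 * _]mulrA addrAC subrr add0r -!mulrA ler_wpM2l//.
    by rewrite mulrCA ler_peMr.
  rewrite -[X in X - _ <= _](@avg_const _ {ffun 'I_n -> draws Delta})
    ?card_outcomes_gt0// -avgB.
  by apply: ler_avg => w; case: ltP => _; rewrite ?subrr ?subr0.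
Qed.
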